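(* Let $P(\partial_z)=\sum_{j\in\Lambda}a_j(z)\partial_z^j$ be a differential operator of order $p\in\mathbb{N}$, where $\Lambda\subset\mathbb{N}_0$ is finite and the coefficients $a_j$ are holomorphic on some neighborhood $D$ of the origin in $\mathbb{C}$. The operator $P(\partial_z)$ is a linear automorphism on $\mathbb{C}[[z]]$ if and only if the following conditions hold: (a) The lower ordinate $m$ of the Newton polygon $N(P)$ is equal to zero. (b) (non-resonance condition) The characteristic polynomial $W_0$ of the operator $P(\partial_z)$ satisfies $W_0(n)\ne0$ for every $n\in\mathbb{N}_0$.
   Context: $\mathbb{N}=\{1,2,\dots\}$, $\mathbb{N}_0=\mathbb{N}\cup\{0\}$. The coefficients $a_j$, $j\in\Lambda$, are nonzero; $\alpha_j:=\mathrm{ord}_z(a_j)$ is the order of the zero of $a_j$ at $z=0$, and $a_j(z)=\sum_{k\ge\alpha_j}a_{j,k}z^k$. The operator acts on formal power series through formal differentiation. The Newton polygon is $N(P)=\mathrm{conv}\{\bigcup_{j\in\Lambda}Q(j,\alpha_j-j)\}$, where $Q(a,b)=\{(x,y)\in\mathbb{R}^2:x\le a,\ y\ge b\}$. Its lower ordinate is $m:=\min_{j\in\Lambda}(\alpha_j-j)\in\mathbb{Z}$. With $\Lambda_m:=\{j\in\Lambda:\alpha_j-j=m\}$, the characteristic polynomial of $P(\partial_z)$ is $$W_m(\lambda):=\sum_{j\in\Lambda_m}a_{j,j+m}\,\lambda(\lambda-1)\cdots(\lambda-j+1)$$ (empty product equal to $1$); it is denoted $W_0$ when $m=0$. *)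

(* Defs.v *)
From HB Require Import structures.
From mathcomp Require Import all_boot all_order all_algebra finmap complex.
From mathcomp Require Import all_classical all_reals all_analysis.

Set Implicit Arguments.
Unset Strict Implicit.
Unset Printing Implicit Defensive.

Import Order.TTheory GRing.Theory Num.Theory.
Import numFieldNormedType.Exports.

Local Open Scope classical_set_scope.
Local Open Scope ring_scope.

(* The complex numbers are [R[i]] for [R : realType]; as a normed module over
   itself this field is [R[i]^o], so that [derivable] on [R[i]^o] is complex
   differentiability. *)

Section FormalSeries.
Variable K : comNzRingType.

(* K[[z]]: the series sum_n (f n) z^n is its coefficient sequence.  The type is
   a named copy because [nat -> K] carries the pointwise product in the
   library, whereas only the module structure is wanted here. *)
Definition formal_series : Type := nat -> K^o.
HB.instance Definition _ := GRing.Lmodule.copy formal_series (nat -> K^o).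

Definition fps_mul (f g : formal_series) : formal_series :=
  fun n => \sum_(i < n.+1) f i * g (n - i)%N.

Definition fps_deriv (f : formal_series) : formal_series :=
  fun n => f n.+1 *+ n.+1.

(* Meaningful for c != 0; the junk value is 0 for c = 0. *)
Definition fps_ord (c : formal_series) : nat :=
  xget 0%N [set n | c n <> 0 /\ forall k, (k < n)%N -> c k = 0].

Definition linear_automorphism (F : formal_series -> formal_series) : Prop :=
  linear F /\ bijective F.

End FormalSeries.

Section DifferentialOperator.
Variables (K : comNzRingType) (Lambda : {fset nat}) (c : nat -> formal_series K).

(* [c j] is the Taylor series at 0 of the coefficient of d^j/dz^j. *)
Definition diff_op (f : formal_series K) : formal_series K :=
  \sum_(j <- Lambda) fps_mul (c j) (iter j (@fps_deriv K) f).

Definition op_order : nat := \max_(j <- Lambda) j.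

Definition ordinate (j : nat) : int := (fps_ord (c j))%:Z - j%:Z.

(* For nonempty Lambda the default value of the iterated minimum is one of the
   values over which the minimum is taken, since op_order belongs to Lambda. *)
Definition lower_ordinate : int :=
  \big[Order.min/ordinate op_order]_(j <- Lambda) ordinate j.

(* j + m = fps_ord (c j) is nonnegative for the indices j of the sum. *)
Definition characteristic_poly : {poly K} :=
  \sum_(j <- Lambda | ordinate j == lower_ordinate)
    c j `|(j%:Z + lower_ordinate)%R|%N *: \prod_(i < j) ('X - i%:R%:P).

End DifferentialOperator.

Section NewtonPolygon.
Variables (R : realType) (K : comNzRingType).
Variables (Lambda : {fset nat}) (c : nat -> formal_series K).

Let plane := convex_lmodType (R^o * R^o)%type.

Definition convex_hull (A : set plane) : set plane :=
  [set x | forall B : set plane, convex_set B -> A `<=` B -> B x].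

Definition quadrant (a b : R) : set plane := [set x | x.1 <= a /\ b <= x.2].

Definition newton_polygon : set plane :=
  convex_hull (\bigcup_(j in [set` Lambda]) quadrant j%:R (ordinate c j)%:~R).

Lemma op_order_in : Lambda != fset0 -> op_order Lambda \in Lambda.
Proof.
case/fset0Pn=> j0 j0L.
have LE (s : seq nat) :
    {subset s <= Lambda} -> j0 \in s -> \max_(j <- s) j \in Lambda.
  move=> sL; rewrite -has_pred1 has_count => s0.
  have {s0} : s != [::] by case: (s) s0.
  elim: s sL => // a [|b s] IH sL _.
    by rewrite big_seq1; apply: sL; rewrite mem_head.
  rewrite big_cons /maxn; case: ifP => _; last by apply: sL; rewrite mem_head.
  by apply: IH => // x xs; apply: sL; rewrite inE xs orbT.
exact: LE.
Qed.

Lemma lower_ordinateP : Lambda != fset0 ->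
  (exists2 j, j \in Lambda & lower_ordinate Lambda c = ordinate c j) /\
  (forall j, j \in Lambda -> lower_ordinate Lambda c <= ordinate c j).
Proof.
move=> L0; split; last by move=> j jL; exact: ge_bigmin_seq.
rewrite /lower_ordinate big_seq.
elim/big_ind: _ => [|x y [i iL ->] [j jL ->]|j jL]; last by exists j.
  by exists (op_order Lambda) => //; exact: op_order_in.
by rewrite minEle; case: ifP => _; [exists i|exists j].
Qed.

Lemma newton_polygon_lower_ordinate : Lambda != fset0 ->
  (exists2 x, newton_polygon x & x.2 = (lower_ordinate Lambda c)%:~R) /\
  (forall x, newton_polygon x -> (lower_ordinate Lambda c)%:~R <= x.2).
Proof.
move=> /lower_ordinateP[[j jL mE] mle]; split.
  exists ((j%:R, (lower_ordinate Lambda c)%:~R) : plane) => // B _; apply.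
  by exists j => //; split => //=; rewrite mE.
set m : R := _%:~R => x Nx.
apply: (Nx [set y | m <= y.2]) => [y z t|y [i /= iL [_]]]; last first.
  by apply: le_trans; rewrite ler_int mle.
rewrite !inE /= => my mz.
have -> : m = t%:num * m + (1 - t%:num) * m.
  by rewrite -mulrDl addrC subrK mul1r.
by apply: lerD; apply: ler_wpM2l => //; rewrite subr_ge0.
Qed.

End NewtonPolygon.

Section Germs.
Variable R : realType.
Implicit Types (D : set R[i]^o) (f : R[i]^o -> R[i]^o).

Definition holomorphic_on D f : Prop := forall z, D z -> derivable f z 1.

(* [c] is the sequence of Taylor coefficients of [f] at 0, i.e.
   f z = sum_k c_k z^k for all z near 0; this determines [c]. *)
Definition taylor_at0 f (c : formal_series R[i]) : Prop :=
  \forall z \near (0 : R[i]^o),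
    series (fun k => c k * z ^+ k : R[i]^o) @ \oo --> f z.

(* D need not be connected, so vanishing is read locally: the order of the zero
   at 0 is defined exactly for the functions that do not vanish near 0. *)
Definition zero_germ f : Prop := \forall z \near (0 : R[i]^o), f z = 0.

End Germs.

(* Main.v *)
(* On coefficients, (P f)_n = \sum_(k <= n - m) T_(n, k) f_k with
   T_(n, n - m) = W_m (n - m).  If m > 0 then (P f)_0 = 0, so P is not
   surjective.  If m = 0 the matrix T is lower triangular with diagonal W_0 n,
   and it is invertible exactly when no diagonal entry vanishes.  If m < 0,
   W_m has no root n >= N for some N: the first N equations of P f = 0 involve
   N - m > N unknowns, hence have a nonzero solution, and each later equation
   determines one new coefficient, so P is not injective. *)
Require Import Defs.
From mathcomp Require Import all_boot all_order all_algebra finmap complex.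
From mathcomp Require Import all_classical all_reals all_analysis.
From mathcomp Require Import zify.
Import Order.TTheory GRing.Theory Num.Theory.
Import numFieldNormedType.Exports.
Local Open Scope classical_set_scope.
Local Open Scope ring_scope.

(** * Recursion, underdetermined linear systems, natural roots of polynomials *)

(** Stage [G n] has the values below [n] computed, and later stages keep them, so the diagonal
    [G k.+1 k] is a solution. *)
Lemma volterra_recursion (K : pzRingType) (b : nat -> K) (A : nat -> nat -> K) :
  exists f : nat -> K, forall k, f k = b k + \sum_(i < k) A k i * f i.
Proof.
pose step n (g : nat -> K) k :=
  if k == n then b n + \sum_(i < n) A n i * g i else g k.
pose G := fix G n := if n is n'.+1 then step n' (G n') else fun=> 0.
have GE n k : (k < n)%N -> G n k = G k.+1 k.
  elim: n => // n IH; rewrite ltnS leq_eqVlt => /predU1P[->//|kn] /=.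
  by rewrite {1}/step ltn_eqF // IH.
exists (fun k => G k.+1 k) => k.
rewrite [LHS]/= {1}/step eqxx; congr (_ + _).
by apply: eq_bigr => i _; rewrite GE.
Qed.

Lemma wide_system_kernel (K : fieldType) (n s : nat) (T : nat -> nat -> K) :
  (0 < s)%N ->
  exists g : nat -> K, (exists2 k, (k < n + s)%N & g k != 0) /\
    forall i, (i < n)%N -> \sum_(k < n + s) T i k * g k = 0.
Proof.
(* [kermx] is a left kernel, so the unknowns index the rows of [A]. Its rank is at most [n], which
   leaves a kernel of dimension at least [s]. *)
move=> s0; pose A : 'M[K]_(n + s, n) := \matrix_(k, i) T i k.
have /rowV0Pn[v /sub_kermxP vA v0] : kermx A != 0.
  rewrite -mxrank_eq0 mxrank_ker subn_eq0 -ltnNge.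
  by rewrite (leq_ltn_trans (rank_leq_col A)) // -addn1 leq_add2l.
pose g k := if insub k is Some i then v 0 i else 0.
have gE (k : 'I_(n + s)) : g k = v 0 k by rewrite /g valK.
exists g; split.
  by case/rV0Pn: v0 => k vk; exists k; rewrite ?gE.
move=> i ltin; have /rowP/(_ (Ordinal ltin)) := vA; rewrite !mxE => vAi.
by rewrite -[RHS]vAi; apply: eq_bigr => k _; rewrite gE mxE mulrC.
Qed.

(** Induction on the size: split off the linear factor of a natural root and take a bound beyond
    that root. Characteristic 0 keeps distinct naturals distinct in [K]. *)
Lemma poly_nat_roots_bounded (K : numFieldType) (p : {poly K}) :
  p != 0 -> exists N, forall n, (N <= n)%N -> p.[n%:R] != 0.
Proof.
have [d] := ubnP (size p); elim: d p => // d IH p; rewrite ltnS => sp p0.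
have [[n /eqP pn]|nroot] := pselect (exists n : nat, p.[n%:R] = 0); last first.
  by exists 0%N => n _; apply/eqP => pn; apply: nroot; exists n.
have /factor_theorem[q pE] : root p n%:R by [].
have q0 : q != 0 by apply: contraNneq p0 => q0; rewrite pE q0 mul0r.
have [|N qN] := IH q _ q0.
  apply: leq_trans sp.
  by rewrite pE size_Mmonic ?monicXsubC // size_XsubC addn2.
exists (maxn N n.+1) => k; rewrite geq_max => /andP[Nk nk].
rewrite pE hornerM mulf_neq0 ?qN // hornerXsubC subr_eq0 eqr_nat.
by rewrite gtn_eqF.
Qed.

Lemma horner_falling (K : comNzRingType) (j n : nat) :
  (\prod_(i < j) ('X - i%:R%:P) : {poly K}).[n%:R] = (n ^_ j)%:R.
Proof.
elim: j => [|j IH]; first by rewrite big_ord0 ffactn0 hornerC.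
rewrite big_ord_recr hornerM IH hornerXsubC ffactnSr natrM.
have [jn|nj] := leqP j n; first by rewrite natrB.
by rewrite ffact_small // !mul0r.
Qed.

(** * The infinite matrix of the operator *)

Section FormalSeriesCoefficients.
Variable K : comNzRingType.
Implicit Types f : formal_series K.

Lemma iter_fps_derivE j f n :
  iter j (@fps_deriv K) f n = f (n + j)%N *+ (n + j) ^_ j.
Proof.
elim: j n => [|j IH] n; first by rewrite addn0 ffactn0.
by rewrite iterS /fps_deriv IH addSnnS -mulrnA ffactnSr addnS -addSn addnK.
Qed.

Lemma fps_ordP f : (exists n, f n <> 0) ->
  f (fps_ord f) <> 0 /\ forall k, (k < fps_ord f)%N -> f k = 0.
Proof.
move=> [n fn].
have exf : exists n, f n != 0 by exists n; apply/eqP.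
apply: (@xgetPex _ 0%N [set n | f n <> 0 /\ forall k, (k < n)%N -> f k = 0]).
case: (ex_minnP exf) => m fm mle; exists m; split; first exact/eqP.
move=> k km; apply/eqP/negPn/negP => /mle.
by rewrite leqNgt km.
Qed.

Variables (Lambda : {fset nat}) (c : nat -> formal_series K).

Lemma diff_opE f n : diff_op Lambda c f n =
  \sum_(j <- Lambda) \sum_(i < n.+1)
    c j i * (f (n - i + j)%N *+ (n - i + j) ^_ j).
Proof.
rewrite /diff_op (big_morph (fun g : formal_series K => g n) (id1 := 0)
  (op1 := +%R)) //.
by apply: eq_bigr => j _; apply: eq_bigr => i _; rewrite iter_fps_derivE.
Qed.

Lemma diff_op_linear : linear (diff_op Lambda c).
Proof.
move=> t f g; apply/funext => n.
transitivity (t * diff_op Lambda c f n + diff_op Lambda c g n) => //.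
rewrite !diff_opE mulr_sumr -big_split; apply: eq_bigr => j _ /=.
rewrite mulr_sumr -big_split; apply: eq_bigr => i _ /=.
rewrite [(t *: f + g) _]/(t * f _ + g _) mulrnDl mulrDr -mulrnAr.
by rewrite mulrCA.
Qed.

(** The coefficient of z^n in P(z^k): the term a_(j, i) z^i d^j contributes exactly when n = k - j +
    i. *)
Definition diff_op_mx (n k : nat) : K :=
  \sum_(j <- Lambda) \sum_(i < n.+1 | k == (n - i + j)%N) c j i *+ k ^_ j.

Hypothesis c_nonzero : forall j, j \in Lambda -> exists n, c j n <> 0.

Lemma coef_below_ordinate j i : j \in Lambda ->
  i%:Z < j%:Z + lower_ordinate Lambda c -> c j i = 0.
Proof.
move=> jL lti; have [_ -> //] := fps_ordP _ (c_nonzero j jL).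
have L0 : Lambda != fset0 by apply/fset0Pn; exists j.
by have [_ /(_ _ jL)] := lower_ordinateP c L0; rewrite /ordinate; lia.
Qed.

Section NonpositiveOrdinate.
Variable s : nat.
Hypothesis ordinate_s : lower_ordinate Lambda c = - s%:Z.

(** Columns beyond n + s drop out: n - i + j > n + s means i < j + m, where a_(j, i) vanishes. *)
Lemma diff_op_mxE f n :
  diff_op Lambda c f n = \sum_(k < (n + s).+1) diff_op_mx n k * f k.
Proof.
under [RHS]eq_bigr do rewrite mulr_suml.
rewrite diff_opE [RHS]exchange_big [LHS]big_seq [RHS]big_seq /=.
apply: eq_bigr => j jL.
under [RHS]eq_bigr do rewrite mulr_suml big_mkcond.
rewrite [RHS]exchange_big /=; apply: eq_bigr => i _.
rewrite -big_mkcond /=; have [le_s|gt_s] := leqP (n - i + j) (n + s).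
  rewrite (big_pred1 (Ordinal (le_s : _ < (n + s).+1)%N)) => [|k].
    by rewrite mulrnAr mulrnAl.
  by rewrite /= -val_eqE.
rewrite coef_below_ordinate ?ordinate_s; last by have := ltn_ord i; lia.
  by rewrite mul0r big1 // => k _; rewrite mul0rn mul0r.
exact: jL.
Qed.

(** Column n + s forces i = j - s = j + m, the index occurring in W_m. For j outside Lambda_m the
    order of a_j exceeds j + m, so the summand is zero. *)
Lemma diff_op_mx_diag n :
  diff_op_mx n (n + s) = (characteristic_poly Lambda c).[(n + s)%:R].
Proof.
rewrite /characteristic_poly horner_sum /diff_op_mx [RHS]big_mkcond /=.
rewrite [LHS]big_seq [RHS]big_seq; apply: eq_bigr => j jL.
have -> : (ordinate c j == lower_ordinate Lambda c) =
          (fps_ord (c j) + s == j)%N.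
  by rewrite ordinate_s /ordinate; lia.
rewrite hornerZ horner_falling ordinate_s mulr_natr.
have [lt_js|le_sj] := ltnP j s.
  rewrite big_pred0 => [|i]; last by have := ltn_ord i; lia.
  by rewrite ifF //; lia.
have -> : `|(j%:Z - s%:Z)%R|%N = (j - s)%N by lia.
transitivity (c j (j - s)%N *+ (n + s) ^_ j).
  have [le_n|gt_n] := ltnP (j - s) n.+1.
    rewrite (big_pred1 (Ordinal le_n)) // => i.
    by rewrite /= -val_eqE /=; have := ltn_ord i; lia.
  (* The index i = j - s is out of range, but then n + s < j and the falling factorial vanishes as
     well. *)
  rewrite big_pred0 => [|i]; last by have := ltn_ord i; lia.
  by rewrite ffact_small //; lia.
case: eqP => // ordj.
have [_ ->] := fps_ordP _ (c_nonzero j jL); first by rewrite mul0rn.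
have L0 : Lambda != fset0 by apply/fset0Pn; exists j.
have [_ /(_ _ jL)] := lower_ordinateP c L0; rewrite ordinate_s /ordinate; lia.
Qed.

End NonpositiveOrdinate.

End FormalSeriesCoefficients.

Arguments coef_below_ordinate {K Lambda c}.

(** * Bijectivity according to the sign of m *)

Section Automorphism.
Variables (K : numFieldType) (Lambda : {fset nat}) (c : nat -> formal_series K).
Hypothesis Lambda_nonempty : Lambda != fset0.
Hypothesis c_nonzero : forall j, j \in Lambda -> exists n, c j n <> 0.
Local Notation P := (diff_op Lambda c).
Local Notation m := (lower_ordinate Lambda c).
Local Notation W := (characteristic_poly Lambda c).
Local Notation T := (diff_op_mx K Lambda c).

(* At the least j of Lambda_m the falling factorials of all larger indices
   vanish, so only the term a_(j, j + m) j! of W_m survives. *)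
Lemma characteristic_poly_neq0 : W != 0.
Proof.
have exL : exists j, (j \in Lambda) && (ordinate c j == m).
  have [[j jL ->] _] := lower_ordinateP c Lambda_nonempty.
  by exists j; rewrite jL eqxx.
case: (ex_minnP exL) => j /andP[jL /eqP jm] jmin.
apply: contra_notN (_ : W.[j%:R] <> 0) => [/eqP->|]; first by rewrite horner0.
rewrite /characteristic_poly horner_sum big_mkcond.
rewrite (bigD1_seq j) ?fset_uniq //= jm eqxx.
rewrite [X in _ + X]big_seq_cond [X in _ + X]big1 => [|i].
  rewrite addr0 hornerZ horner_falling ffactnn; apply/eqP.
  rewrite mulf_neq0 ?pnatr_eq0 -?lt0n ?fact_gt0 //; apply/eqP.
  have -> : `|(j%:Z + m)%R|%N = fps_ord (c j) by rewrite -jm /ordinate; lia.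
  by have [] := fps_ordP _ _ (c_nonzero _ jL).
case/andP=> iL ij; case: ifP => // im.
have ji : (j < i)%N by rewrite ltn_neqAle eq_sym ij jmin // iL.
by rewrite hornerZ horner_falling ffact_small // mulr0.
Qed.

(** All a_j(0) vanish, so a series with nonzero constant term, here the one with all coefficients 1,
    is not reached. *)
Lemma positive_ordinate_not_surjective : 0 < m ->
  ~ (forall g, exists f, P f = g).
Proof.
move=> m0 /(_ (fun=> 1))[f /(congr1 (fun g : formal_series K => g 0%N))].
rewrite diff_opE big_seq big1 => [/esym/eqP|j jL].
  by rewrite (oner_eq0 K).
rewrite big_ord1 (coef_below_ordinate c_nonzero) ?mul0r //=.
by rewrite (lt_le_trans m0) // lerDr.
Qed.

Lemma negative_ordinate_not_injective : m < 0 -> ~ injective P.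
Proof.
move=> m0 Pinj; pose s := `|m|%N.
have ms : m = - s%:Z by rewrite /s; lia.
have s0 : (0 < s)%N by rewrite /s; lia.
have [N WN] := poly_nat_roots_bounded _ _ characteristic_poly_neq0.
(* Row [n] is cut after column n + s, so that its sum over all N + s columns is the formula for (P
   f)_n. *)
pose T' n k := if (k < (n + s).+1)%N then T n k else 0.
have [g [[k0 k0N gk0] gT]] := wide_system_kernel _ N s T' s0.
(* The kernel vector prescribes the first N + s coefficients; each later f_k is solved from equation
   k - s, whose leading factor W(k) is nonzero. *)
have [f fE] := volterra_recursion _ (fun k => if (k < N + s)%N then g k else 0)
  (fun k i => if (k < N + s)%N then 0 else - (W.[k%:R]^-1 * T (k - s)%N i)).
have fg k : (k < N + s)%N -> f k = g k.
  by move=> kN; rewrite fE kN big1 ?addr0 // => i _; rewrite mul0r.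
suff Pf : P f = P 0.
  by move: gk0; rewrite -fg // (Pinj _ _ Pf) eqxx.
apply/funext => n; rewrite !(diff_op_mxE _ _ _ c_nonzero _ ms).
rewrite [RHS]big1 => [|k _]; last by rewrite mulr0.
have [nN|Nn] := ltnP n N.
  rewrite -[RHS](gT n nN).
  rewrite (big_ord_widen (N + s) (fun k => T n k * f k)) ?ltn_add2r //.
  rewrite big_mkcond; apply: eq_bigr => k _; rewrite /T'.
  by case: ifP => _; rewrite ?mul0r // fg.
rewrite big_ord_recr /= (fE (n + s)%N) ltn_add2r ltnNge Nn /= addnK add0r.
rewrite (diff_op_mx_diag _ _ _ c_nonzero _ ms) mulr_sumr -big_split.
rewrite big1 //= => k _.
by rewrite mulNr mulrN -mulrA mulVKf ?subrr // WN // (leq_trans Nn) ?leq_addr.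
Qed.

Hypothesis m_eq0 : m = 0.

Lemma zero_ordinate_diff_opE f n :
  P f n = \sum_(k < n) T n k * f k + W.[n%:R] * f n.
Proof.
have m0 : m = - 0%:Z by rewrite m_eq0 oppr0.
have := diff_op_mx_diag _ _ _ c_nonzero _ m0 n.
by rewrite (diff_op_mxE _ _ _ c_nonzero _ m0) !addn0 big_ord_recr => <-.
Qed.

Lemma zero_ordinate_surjectiveP : (forall g, exists f, P f = g) <->
  forall n : nat, W.[n%:R] <> 0.
Proof.
split=> [Psurj n Wn|W0 g].
  have exW : exists n : nat, W.[n%:R] == 0 by exists n; exact/eqP.
  (* With [n] the least root, a preimage of z^n has zero coefficients below [n], and row [n] then
     reads 0 = 1. *)
  case: (ex_minnP exW) => {Wn}n /eqP Wn nmin.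
  have [f Pf] := Psurj (fun k => (k == n)%:R).
  have f0 k : (k < n)%N -> f k = 0.
    elim/ltn_ind: k => k IH kn.
    have /(congr1 (fun g : formal_series K => g k)) := Pf.
    rewrite zero_ordinate_diff_opE (ltn_eqF kn) big1 => [|i _]; last first.
      by rewrite IH ?mulr0 // (ltn_trans _ kn).
    rewrite add0r => /eqP; rewrite mulf_eq0 => /orP[/nmin|/eqP//].
    by rewrite leqNgt kn.
  have /(congr1 (fun g : formal_series K => g n)) := Pf.
  rewrite zero_ordinate_diff_opE Wn mul0r addr0 eqxx.
  rewrite big1 => [/esym/eqP|i _]; last first.
    by rewrite f0 ?mulr0.
  by rewrite (oner_eq0 K).
(* Forward substitution in the triangular system. *)
have [f fE] := volterra_recursion _ (fun k => W.[k%:R]^-1 * g k)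
  (fun k i => - (W.[k%:R]^-1 * T k i)).
exists f; apply/funext => n.
rewrite zero_ordinate_diff_opE fE mulrDr mulVKf; last exact/eqP.
rewrite mulr_sumr addrCA -big_split big1 ?addr0 //= => k _.
by rewrite mulNr mulrN -mulrA mulVKf ?subrr //; exact/eqP.
Qed.

(** Once the earlier coefficients agree, row [n] reduces to W(n) f_n = W(n) g_n. *)
Lemma zero_ordinate_injective : (forall n : nat, W.[n%:R] <> 0) -> injective P.
Proof.
move=> W0 f g Pfg; apply/funext; elim/ltn_ind => n IH.
have /(congr1 (fun h : formal_series K => h n)) := Pfg.
rewrite !zero_ordinate_diff_opE; under eq_bigr do rewrite IH //.
by move/addrI; apply: mulfI; exact/eqP.
Qed.

End Automorphism.

(** If all Taylor coefficients were zero, the partial sums would be 0 and uniqueness of limits would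
    make the germ zero. *)
Lemma taylor_at0_neq0 (R : realType) (f : R[i]^o -> R[i]^o)
    (c : formal_series R[i]) :
  taylor_at0 f c -> ~ zero_germ f -> exists n, c n <> 0.
Proof.
move=> cf f0; apply: contrapT => c0; apply: f0.
apply: filterS cf => z cfz.
suff cf0 : series (fun k => c k * z ^+ k : R[i]^o) @ \oo --> (0 : R[i]^o).
  exact: (cvg_unique _ cfz cf0).
rewrite (_ : series _ = cst 0); first exact: cvg_cst.
apply/funext => n; rewrite /series /= big1 // => k _.
suff -> : c k = 0 by rewrite mul0r.
by apply: contrapT => ck; apply: c0; exists k.
Qed.

Theorem theorem1 (R : realType) (p : nat) (Lambda : {fset nat})
    (D : set R[i]^o) (a : nat -> R[i]^o -> R[i]^o)
    (c : nat -> formal_series R[i])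
    (p_gt0 : (0 < p)%N)
    (order_p : op_order Lambda = p)
    (D_open : open D) (D_0 : D 0)
    (a_holomorphic : forall j, j \in Lambda -> holomorphic_on D (a j))
    (a_nonzero : forall j, j \in Lambda -> ~ zero_germ (a j))
    (a_taylor : forall j, j \in Lambda -> taylor_at0 (a j) (c j)) :
  linear_automorphism (diff_op Lambda c) <->
  lower_ordinate Lambda c = 0 /\
  (forall n : nat, (characteristic_poly Lambda c).[n%:R] <> 0).
Proof.
have L0 : Lambda != fset0.
  (* The maximum over an empty index set is 0, contradicting a positive order. *)
  apply: contraTneq p_gt0 => L0.
  by rewrite -order_p L0 /op_order big_seq big1.
have c0 j : j \in Lambda -> exists n, c j n <> 0.
  by move=> jL; exact: taylor_at0_neq0 (a_taylor j jL) (a_nonzero j jL).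
split=> [[_ [Q PK QK]]|[m0 W0]].
  have Psurj g : exists f, diff_op Lambda c f = g by exists (Q g); exact: QK.
  have m0 : lower_ordinate Lambda c = 0.
    have [mlt|mgt|//] := ltgtP (lower_ordinate Lambda c) 0.
      have := negative_ordinate_not_injective _ _ _ L0 c0 mlt.
      by move=> /(_ (can_inj PK)).
    by have /(_ Psurj) := positive_ordinate_not_surjective _ _ _ c0 mgt.
  by split=> //; apply/(zero_ordinate_surjectiveP _ _ _ c0 m0).
split; first exact: diff_op_linear.
(* Choice gives a right inverse; injectivity makes it two-sided, since P(Q(P f)) = P f. *)
have /choice[Q QK] := (zero_ordinate_surjectiveP _ _ _ c0 m0).2 W0.
exists Q => // f.
by apply: (zero_ordinate_injective _ _ _ c0 m0 W0); rewrite QK.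
Qed.
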